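(* Let $a>0$, $\phi_a(x)=e^{-ax^2}$, and let $f=\sum_{k\in\mathbb{Z}}c_k\phi_a(\cdot-k)$ with $c\in\ell^\infty(\mathbb{Z})$, $f\not\equiv0$. Let $N_f$ be its set of real zeros, with multiplicities $m_f(x)$, $x\in N_f$. Then $D^-(N_f,m_f)\le1$.
   Context: The multiplicity $m_f(x)$ of a real zero $x$ is the order of vanishing of $f$ at $x$, i.e. the largest $m$ with $f^{(j)}(x)=0$ for $0\le j<m$. $D^-(N,m)=\liminf_{r\to\infty}\inf_{x\in\mathbb{R}}\frac{1}{2r}\sum_{\lambda\in N\cap[x-r,x+r]}m(\lambda)$. *)

(* Defs.v *)
From HB Require Import structures.
From mathcomp Require Import all_boot all_order all_algebra.
From mathcomp Require Import all_classical all_reals all_analysis.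
From mathcomp Require Import complex.
Set Implicit Arguments. Unset Strict Implicit. Unset Printing Implicit Defensive.
Import Order.TTheory GRing.Theory Num.Theory numFieldNormedType.Exports.
Local Open Scope classical_set_scope.
Local Open Scope ring_scope.

Section Defs.
Variable R : realType.

Definition gauss (a x : R) : R := expR (- (a * x ^+ 2)).

Definition gpsum (a : R) (d : int -> R) (x : R) (n : nat) : R :=
  \sum_(0 <= i < (2 * n).+1) d (i%:Z - n%:Z) * gauss a (x - (i%:Z - n%:Z)%:~R).

Definition fRe (a : R) (c : int -> R[i]) (x : R) : R :=
  limn (gpsum a (fun k => complex.Re (c k)) x).
Definition fIm (a : R) (c : int -> R[i]) (x : R) : R :=
  limn (gpsum a (fun k => complex.Im (c k)) x).

Definition zeroset (a : R) (c : int -> R[i]) : set R :=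
  [set x | fRe a c x = 0 /\ fIm a c x = 0].

(* m_f(x): largest m with f^(j)(x) = 0 for all j < m
   (f^(j) = (Re f)^(j) + i (Im f)^(j)); valued in \bar R (+oo if no largest) *)
Definition mult (a : R) (c : int -> R[i]) (x : R) : \bar R :=
  ereal_sup [set (m%:R)%:E | m in
    [set m : nat | forall j : nat, (j < m)%N ->
        derive1n j (fRe a c) x = 0 /\ derive1n j (fIm a c) x = 0]].

(* D^-(N,m) = liminf_{r->oo} inf_x (1/2r) sum_{lambda in N cap [x-r,x+r]} m(lambda) *)
Definition lower_density (N : set R) (m : R -> \bar R) : \bar R :=
  ereal_sup [set ereal_inf [set
      ereal_inf [set (((2 * r)^-1)%:E *
                     \esum_(l in N `&` [set l : R | (x - r <= l <= x + r)%R]) m l)%E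
                 | x in [set: R]]
      | r in [set r | r0 <= r]] | r0 in [set: R]].

End Defs.

(* Main.v *)
Require Import Defs.
From HB Require Import structures.
From mathcomp Require Import all_boot all_order all_algebra.
From mathcomp Require Import all_classical all_reals all_analysis.
From mathcomp Require Import complex.
From mathcomp Require Import ring lra zify.
Import Order.TTheory GRing.Theory Num.Theory numFieldNormedType.Exports.
Local Open Scope classical_set_scope.
Local Open Scope ring_scope.

(** Write [f x = exp (- a x^2) * L (exp (2 a x))], where [L] is the Laurent
    series with coefficients [b k = c k * exp (- a k^2)].  A real zero of [f],
    counted with multiplicity, is a positive zero [l] of [L].  Dividing [L] by
    [z - l] gives a series with coefficients
    [h k = \sum_(i > k) b i * l^(i - k - 1)], which is also
    [- \sum_(i <= k) b i * l^(i - k - 1)] because [L l = 0].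
    For the norms [|b|_r = sup_k |b k| r^k] these two expressions yield
    [|r - l| |h|_r <= |b|_r], and [b k = h (k - 1) - l * h k] yields
    [|b|_1 <= (1 + l) |h|_1], while [|h|_1^2 <= |h|_r |h|_(1/r)].  Dividing out
    all zeros in [[-n, n]] with [r = exp (2 a n + 5)], and using that [c] is
    bounded, one gets the Jensen-type inequality
    [\sum_x (n - |x|) <= (n + 5 / (2 a))^2 + K], the sum being over these zeros.
    A lower density [D > 1] would make the left-hand side at least
    [D n^2 - O(n)].  If [c] is complex, it is enough to apply this to whichever
    of [Re f] and [Im f] is not identically zero. *)

Set Implicit Arguments.
Unset Strict Implicit.

Section EntirePowerSeries.
Context {R : realType}.
Implicit Types (c : nat -> R) (x r C : R).

Definition entire c :=
  forall r, 0 < r -> exists C, forall n, `|c n| * r ^+ n <= C.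

Definition psum c x : R := limn (pseries c x).

Lemma entire_behead c : entire c -> entire (fun n => c n.+1).
Proof.
move=> ec r r0; have [C cC] := ec _ r0; exists (C / r) => n.
by rewrite ler_pdivlMr// -mulrA -exprSr.
Qed.

Lemma entire_pseries_diffs c : entire c -> entire (pseries_diffs c).
Proof.
move=> ec r r0; have [|C cC] := ec (2 * r); first by rewrite mulr_gt0.
exists (C / r) => n; rewrite ler_pdivlMr// (le_trans _ (cC n.+1))//.
rewrite /pseries_diffs normrM -mulrA -exprSr mulrAC mulrC ler_wpM2l//.
rewrite exprMn ler_wpM2r ?exprn_ge0 ?(ltW r0)//.
by rewrite normr_nat -natrX ler_nat ltnW// ltn_expl.
Qed.

Section CauchyEstimate.
Variables (c : nat -> R) (r x C : R).
Hypotheses (xr : `|x| < r) (cC : forall n, `|c n| * r ^+ n <= C).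

Let r_gt0 : 0 < r. Proof. exact: le_lt_trans xr. Qed.

Let ratio_lt1 : `| `|x| / r | < 1.
Proof.
by rewrite normrM normr_id normfV (gtr0_norm r_gt0) ltr_pdivrMr// mul1r.
Qed.

Let term_le_geometric n : `|c n * x ^+ n| <= geometric C (`|x| / r) n.
Proof.
rewrite /= normrM normrX expr_div_n mulrA mulrAC.
by rewrite ler_wpM2r ?exprn_ge0// ler_pdivlMr ?exprn_gt0.
Qed.

Let is_cvg_normed_pseries : cvgn [normed pseries c x].
Proof.
apply: (series_le_cvg _ _ term_le_geometric) => [n|n|]; first exact: normr_ge0.
  exact: le_trans (term_le_geometric n).
exact: is_cvg_geometric_series ratio_lt1.
Qed.

Lemma is_cvg_pseries_bounded : cvgn (pseries c x).
Proof. exact: normed_cvg. Qed.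

Lemma ler_norm_psum : `|psum c x| <= C / (1 - `|x| / r).
Proof.
rewrite (le_trans (lim_series_norm is_cvg_normed_pseries))//.
have cvg_geo := cvg_geometric_series (a := C) ratio_lt1.
rewrite -(cvg_lim _ cvg_geo)//.
exact: lim_series_le is_cvg_normed_pseries (cvgP _ cvg_geo) term_le_geometric.
Qed.

End CauchyEstimate.

Lemma is_cvg_psum c x : entire c -> cvgn (pseries c x).
Proof.
move=> ec; have [|C cC] := ec (`|x| + 1); first by rewrite ltr_wpDl.
by apply: is_cvg_pseries_bounded cC; rewrite ltrDl.
Qed.

Lemma psum_recl c x : entire c ->
  psum c x = c 0%N + x * psum (fun n => c n.+1) x.
Proof.
move=> ec; apply/cvg_lim => //; rewrite -cvg_shiftS.
have -> : [sequence pseries c x n.+1]_n =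
    (fun n => c 0%N + x * pseries (fun n => c n.+1) x n).
  apply/funext => n; rewrite /pseries /series /= big_nat_recl//= expr0 mulr1.
  congr (_ + _); rewrite mulr_sumr; apply: eq_bigr => i _.
  by rewrite exprS mulrCA.
apply: cvgD; first exact: cvg_cst.
by apply: cvgMl_tmp; exact/is_cvg_psum/entire_behead.
Qed.

Lemma psumBZ c1 c2 (k x : R) : entire c1 -> entire c2 ->
  psum (fun n => c1 n - k * c2 n) x = psum c1 x - k * psum c2 x.
Proof.
move=> ec1 ec2; apply/cvg_lim => //.
have -> : pseries (fun n => c1 n - k * c2 n) x =
    (fun n => pseries c1 x n - k * pseries c2 x n).
  apply/funext => n; rewrite /pseries /series/= mulr_sumr -sumrB.
  by apply: eq_bigr => i _; rewrite mulrBl mulrA.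
by apply: cvgB; [exact: is_cvg_psum|apply: cvgMl_tmp; exact: is_cvg_psum].
Qed.

Lemma is_derive_psum c x : entire c ->
  is_derive x 1 (psum c) (psum (pseries_diffs c) x).
Proof.
move=> ec; have ec' := entire_pseries_diffs ec.
have ec'' := entire_pseries_diffs ec'.
apply: (@pseries_snd_diffs _ _ (`|x| + 1)); [exact: is_cvg_psum..|].
by rewrite [ltRHS]ger0_norm ?ltrDl// addr_ge0.
Qed.

Lemma continuous_psum c : entire c -> continuous (psum c).
Proof.
move=> ec x; apply: differentiable_continuous; apply/derivable1_diffP.
by have [] := is_derive_psum x ec.
Qed.

End EntirePowerSeries.

Section LaurentSeries.
Context {R : realType}.
Implicit Types (b : int -> R) (k : int) (l z r M : R).

Definition coef_bounded b r M := forall k, `|b k| * r ^ k <= M.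

(* The coefficient sequences of the Laurent series converging on [z != 0]. *)
Definition bientire b := forall r, 0 < r -> exists M, coef_bounded b r M.

Lemma coef_bounded_shift b r M k : 0 < r -> coef_bounded b r M ->
  coef_bounded (fun i => b (i + k)) r (M / r ^ k).
Proof.
by move=> r0 bM i; rewrite ler_pdivlMr ?exprz_gt0// -mulrA -expfzDr ?gt_eqF.
Qed.

Lemma coef_bounded_interpolate b r1 r r2 M1 M2 : 0 < r1 -> r1 <= r <= r2 ->
  coef_bounded b r1 M1 -> coef_bounded b r2 M2 ->
  coef_bounded b r (Num.max M1 M2).
Proof.
move=> r10 /andP[r1r rr2] bM1 bM2 k; rewrite le_max; apply/orP.
have r0 : 0 < r := lt_le_trans r10 r1r.
have [k0|/ltW k0] := leP 0 k.
  right; apply: le_trans (bM2 k); rewrite ler_wpM2l//.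
  by apply: ler_wpXz2r; rewrite // nnegrE ltW// (lt_le_trans r0).
left; apply: le_trans (bM1 k); rewrite ler_wpM2l//.
by apply: ler_wnXz2r.
Qed.

Lemma bientire_shift b k : bientire b -> bientire (fun i => b (i + k)).
Proof.
move=> eb r r0; have [M bM] := eb _ r0.
by exists (M / r ^ k); exact: coef_bounded_shift.
Qed.

Lemma bientire_entire_pos b : bientire b -> entire (fun n => b n%:Z).
Proof. by move=> eb r r0; have [M bM] := eb _ r0; exists M => n; exact: bM. Qed.

Lemma coef_bounded_neg b r M n : 0 < r -> coef_bounded b r M ->
  `|b (- 1 - n%:Z)| * r^-1 ^+ n <= M * r.
Proof.
move=> r0 bM; rewrite -ler_pdivrMr//; apply: le_trans (bM (- 1 - n%:Z)).
by rewrite expfzDr ?gt_eqF// -[r ^ (- n%:Z)]exprnN exprN1 exprVn mulrA mulrAC.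
Qed.

Lemma bientire_entire_neg b : bientire b -> entire (fun n => b (- 1 - n%:Z)).
Proof.
move=> eb r r0; have rV0 : 0 < r^-1 by rewrite invr_gt0.
have [M bM] := eb _ rV0; exists (M * r^-1) => n.
by rewrite -{1}[r]invrK; exact: coef_bounded_neg.
Qed.

Definition laurent b z : R :=
  psum (fun n => b n%:Z) z + z^-1 * psum (fun n => b (- 1 - n%:Z)) z^-1.

Lemma laurentBZ b1 b2 (x z : R) : bientire b1 -> bientire b2 ->
  laurent (fun k => b1 k - x * b2 k) z = laurent b1 z - x * laurent b2 z.
Proof.
move=> eb1 eb2; rewrite /laurent.
rewrite psumBZ; [|exact: bientire_entire_pos..].
by rewrite psumBZ; [ring|exact: bientire_entire_neg..].
Qed.

Lemma laurent_succ b z : z != 0 -> bientire b ->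
  laurent b z = z * laurent (fun i => b (i + 1)) z.
Proof.
move=> z0 eb; rewrite /laurent psum_recl; last exact: bientire_entire_pos.
rewrite [X in _ = z * (_ + z^-1 * X)]psum_recl; last first.
  exact: bientire_entire_neg (bientire_shift 1 eb).
rewrite subr0 addNr.
have -> : (fun n : nat => b n.+1) = (fun n : nat => b (n%:Z + 1)).
  by apply/funext => n; rewrite -addn1 PoszD.
have -> : (fun n : nat => b (- 1 - n.+1%:Z + 1)) =
    (fun n : nat => b (- 1 - n%:Z)).
  by apply/funext => n; congr b; lia.
by field.
Qed.

Lemma laurent_shift b k z : z != 0 -> bientire b ->
  laurent b z = z ^ k * laurent (fun i => b (i + k)) z.
Proof.
move=> z0 eb; elim: k => [|n IHn|n IHn].
- by rewrite mul1r; congr laurent; apply/funext => i; rewrite addr0.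
- rewrite IHn laurent_succ//; last exact: bientire_shift.
  rewrite mulrA -addn1 PoszD expfzDr//; congr (_ * laurent _ _).
  by apply/funext => i; congr b; lia.
- rewrite IHn -addn1 PoszD opprD expfzDr//.
  rewrite [in RHS]laurent_succ//; last exact: bientire_shift.
  rewrite exprN1 -mulrA mulKf//; congr (_ * laurent _ _).
  by apply/funext => i; congr b; lia.
Qed.

Lemma laurent0 z : laurent (fun=> 0) z = 0.
Proof.
suff psum0 (x : R) : psum (fun=> 0) x = 0.
  by rewrite /laurent !psum0 mulr0 addr0.
apply/cvg_lim => //; rewrite (_ : pseries _ _ = fun=> 0); first exact: cvg_cst.
by apply/funext => n; rewrite /pseries/series/= big1// => i _; rewrite mul0r.
Qed.

Lemma continuous_laurent b z : z != 0 -> bientire b ->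
  {for z, continuous (laurent b)}.
Proof.
move=> z0 eb; apply: cvgD; first exact/continuous_psum/bientire_entire_pos.
apply: cvgM; first exact: cvgV.
apply: (cvg_comp _ _ (cvgV z0 cvg_id)).
exact/continuous_psum/bientire_entire_neg.
Qed.

End LaurentSeries.

Section LaurentQuotient.
Context {R : realType}.
Variables (b : int -> R) (l : R).
Hypotheses (l_gt0 : 0 < l) (eb : bientire b).

(* The coefficients of [laurent b z / (z - l)] when [laurent b l = 0]. *)
Definition laurent_quo (k : int) : R := psum (fun n => b (n%:Z + (k + 1))) l.

Lemma laurent_quo_pred k : laurent_quo (k - 1) = b k + l * laurent_quo k.
Proof.
rewrite {1}/laurent_quo subrK psum_recl.
  rewrite add0r; congr (_ + _ * psum _ _).
  by apply/funext => n; congr b; lia.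
exact: bientire_entire_pos (bientire_shift k eb).
Qed.

Hypothesis bl0 : laurent b l = 0.

Lemma laurent_quo_neg k :
  laurent_quo k = - (l^-1 * psum (fun n => b (- 1 - n%:Z + (k + 1))) l^-1).
Proof.
have l0 : l != 0 by rewrite gt_eqF.
apply/eqP; rewrite -addr_eq0; apply/eqP/(mulfI (expfz_neq0 (k + 1) l0)).
by rewrite mulr0 -bl0 [RHS](laurent_shift (k + 1)).
Qed.

Lemma coef_bounded_laurent_quo r M : 0 < r -> r != l -> coef_bounded b r M ->
  coef_bounded laurent_quo r (M / `|r - l|).
Proof.
move=> r0 rl bM k; have rk0 : 0 < r ^ k by exact: exprz_gt0.
have bkM := coef_bounded_shift (k + 1) r0 bM.
rewrite -ler_pdivlMr//.
have [{}rl|{}rl|/eqP] := ltgtP r l; last by rewrite (negPf rl).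
- have lVrV : `|l^-1| < r^-1 by rewrite gtr0_norm ?invr_gt0// ltf_pV2 ?posrE.
  rewrite laurent_quo_neg normrN normrM gtr0_norm ?invr_gt0//.
  rewrite -ler_pdivlMl ?invr_gt0// invrK.
  apply: le_trans (ler_norm_psum lVrV (fun n => coef_bounded_neg n r0 bkM)) _.
  rewrite gtr0_norm ?invr_gt0// ltr0_norm ?subr_lt0// opprB expfzDr ?gt_eqF//.
  rewrite expr1z; move: (r ^ k) rk0 => rk rk0.
  rewrite [leLHS](_ : _ = l * (M / (l - r) / rk))//.
  by field; rewrite !gt_eqF ?subr_gt0.
- have lr : `|l| < r by rewrite gtr0_norm.
  apply: le_trans (ler_norm_psum lr (fun n => bkM n)) _.
  rewrite !gtr0_norm ?subr_gt0// expfzDr ?gt_eqF//.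
  rewrite expr1z; move: (r ^ k) rk0 => rk rk0.
  rewrite [leLHS](_ : _ = M / (r - l) / rk)//.
  by field; rewrite !gt_eqF ?subr_gt0.
Qed.

Lemma bientire_laurent_quo : bientire laurent_quo.
Proof.
move=> r r0; have l0 := l_gt0.
have bounded_off_l (s : R) : 0 < s -> s != l ->
    exists M, coef_bounded laurent_quo s M.
  move=> s0 sl; have [M bM] := eb s0.
  by exists (M / `|s - l|); exact: coef_bounded_laurent_quo.
have [->|] := eqVneq r l; last exact: bounded_off_l.
have [||M1 bM1] := bounded_off_l (l / 2); [lra|by rewrite lt_eqF//; lra|].
have [||M2 bM2] := bounded_off_l (2 * l); [lra|by rewrite gt_eqF//; lra|].
exists (Num.max M1 M2); apply: coef_bounded_interpolate bM1 bM2; lra.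
Qed.

Lemma laurent_factor z :
  z != 0 -> laurent b z = (z - l) * laurent laurent_quo z.
Proof.
move=> z0; have eh := bientire_laurent_quo.
have -> : b = fun k => laurent_quo (k - 1) - l * laurent_quo k.
  by apply/funext => k; rewrite laurent_quo_pred addrK.
rewrite laurentBZ//; last exact: bientire_shift.
by rewrite [laurent laurent_quo z](laurent_shift (- 1))// exprN1; field.
Qed.

Lemma coef_bounded1_laurent_quo M : coef_bounded laurent_quo 1 M ->
  coef_bounded b 1 ((1 + l) * M).
Proof.
move=> hM k; have {}hM i : `|laurent_quo i| <= M.
  by have := hM i; rewrite exp1rz mulr1.
have -> : b k = laurent_quo (k - 1) - l * laurent_quo k.
  by rewrite laurent_quo_pred addrK.
rewrite exp1rz mulr1 (le_trans (ler_normB _ _))// mulrDl mul1r lerD//.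
by rewrite normrM gtr0_norm// ler_pM2l.
Qed.

End LaurentQuotient.

Section SmoothFunctions.
Context {R : realType}.
Implicit Types (f g : R -> R) (n : nat).

Fixpoint times_derivable n f : Prop :=
  if n is m.+1 then
    exists2 df, times_derivable m df & forall x : R, is_derive x 1 f (df x)
  else True.

Definition smooth f := forall n, times_derivable n f.

Lemma times_derivableW n f : times_derivable n.+1 f -> times_derivable n f.
Proof.
elim: n f => // n IHn f [df ndf f_df]; exists df => //; exact: IHn.
Qed.

Lemma smooth_derivable f x : smooth f -> derivable f x 1.
Proof. by move=> /(_ 1%N)[df _ /(_ x)[]]. Qed.

Lemma smooth_continuous f : smooth f -> continuous f.
Proof.
move=> sf x; apply: differentiable_continuous.
exact/derivable1_diffP/smooth_derivable.
Qed.

Lemma smooth_derive1 f : smooth f -> smooth (derive1 f).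
Proof.
move=> sf n; have [df ndf f_df] := sf n.+1; suff -> : derive1 f = df by [].
by apply/funext => x; rewrite derive1E derive_val.
Qed.

Lemma smooth_cst (k : R) : smooth (cst k).
Proof.
move=> n; elim: n k => // n IHn k; exists (cst 0) => // x.
exact: is_derive_cst.
Qed.

Lemma smooth_id : smooth id.
Proof.
by case=> // n; exists (cst 1) => [|x]; [exact: smooth_cst|exact: is_derive_id].
Qed.

Lemma smooth_expR : smooth expR.
Proof. by elim=> // n IHn; exists expR => // x; exact: is_derive_expR. Qed.

Lemma smooth_psum c : entire c -> smooth (psum c).
Proof.
move=> ec n; elim: n c ec => // n IHn c ec.
exists (psum (pseries_diffs c)) => [|x]; last exact: is_derive_psum.
exact/IHn/entire_pseries_diffs.
Qed.

Lemma times_derivableD n f g :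
  times_derivable n f -> times_derivable n g -> times_derivable n (f + g).
Proof.
elim: n f g => // n IHn f g [df ndf f_df] [dg ndg g_dg].
by exists (df + dg) => [|x]; [exact: IHn|exact: is_deriveD].
Qed.

Lemma times_derivableM n f g :
  times_derivable n f -> times_derivable n g -> times_derivable n (f * g).
Proof.
elim: n f g => // n IHn f g nf ng.
have [[df ndf f_df] [dg ndg g_dg]] := (nf, ng).
exists (f * dg + g * df) => [|x]; last exact: is_deriveM.
by apply: times_derivableD; apply: IHn => //; exact: times_derivableW.
Qed.

Lemma times_derivable_comp n f g :
  times_derivable n f -> times_derivable n g -> times_derivable n (f \o g).
Proof.
elim: n f g => // n IHn f g nf ng.
have [[df ndf f_df] [dg ndg g_dg]] := (nf, ng).
exists ((df \o g) * dg) => [|x]; last exact: is_derive1_comp.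
by apply: times_derivableM => //; apply: IHn => //; exact: times_derivableW.
Qed.

Lemma smoothD f g : smooth f -> smooth g -> smooth (f + g).
Proof. by move=> sf sg n; exact: times_derivableD. Qed.

Lemma smoothM f g : smooth f -> smooth g -> smooth (f * g).
Proof. by move=> sf sg n; exact: times_derivableM. Qed.

Lemma smooth_comp f g : smooth f -> smooth g -> smooth (f \o g).
Proof. by move=> sf sg n; exact: times_derivable_comp. Qed.

Lemma smooth_scale (k : R) : smooth (cst k * id).
Proof. by apply: smoothM; [exact: smooth_cst|exact: smooth_id]. Qed.

Lemma smooth_expR_comp f : smooth f -> smooth (expR \o f).
Proof. by apply: smooth_comp; exact: smooth_expR. Qed.

Lemma smooth_gauss (k : R) : smooth (gauss k).
Proof.
have -> : gauss k = expR \o ((cst (- k) * id) * id).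
  by apply/funext => x; rewrite /gauss !fctE/= expr2 mulrA !mulNr.
by apply/smooth_expR_comp/smoothM; [exact: smooth_scale|exact: smooth_id].
Qed.

End SmoothFunctions.

Section VanishingOrder.
Context {R : realType}.
Implicit Types (f g u : R -> R) (x y : R) (m n : nat) (s : seq R).

Lemma near_dnbhsP x (P : set R) : (\forall y \near x^', P y) <->
  exists2 d, 0 < d & forall y, y != x -> `|y - x| < d -> P y.
Proof.
rewrite /dnbhs near_withinE; split=> [/nbhs_ballP[d /= d0 dP]|[d d0 dP]].
  by exists d => // y yx yd; apply: dP => //; rewrite /ball/= distrC.
by apply/nbhs_ballP; exists d => // y; rewrite /ball/= distrC => yd /dP; exact.
Qed.

Lemma derivable_lipschitz_at f x : derivable f x 1 ->
  exists K, \forall y \near x^', `|f y - f x| <= K * `|y - x|.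
Proof.
move=> fx; exists (`|'D_1 f x| + 1).
have norm_lt : `|'D_1 f x| < `|'D_1 f x| + 1 by rewrite ltrDl.
have : \forall h \near (0 : R)^',
    `|h^-1 *: (f (h *: 1 + x) - f x)| <= `|'D_1 f x| + 1.
  exact: cvgr_norm_le ('D_1 f x) fx _ norm_lt.
move=> /near_dnbhsP[d d0 quo_le].
apply/near_dnbhsP; exists d => // y yx yd; have := quo_le (y - x).
rewrite subr0 subr_eq0 => /(_ yx yd).
rewrite [_ *: 1]mulr1 subrK normrZ normfV ler_pdivrMl 1?mulrC//.
by rewrite normr_gt0 subr_eq0.
Qed.

Lemma mean_value_between f x y : (forall t, derivable f t 1) -> y != x ->
  exists w, [/\ w != x, `|w - x| <= `|y - x| &
    `|f y - f x| = `|derive1 f w| * `|y - x|].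
Proof.
move=> df yx.
have mvt a b : a < b ->
    exists2 w, w \in `]a, b[ & f b - f a = derive1 f w * (b - a).
  move=> ab; apply: MVT ab _ _ => [t _|].
    by rewrite derive1E; exact/derivableP.
  exact: derivable_within_continuous.
have [xy|xy|/eqP] := ltgtP x y; last by rewrite eq_sym (negPf yx).
- have [w /[!in_itv]/= /andP[xw wy] E] := mvt _ _ xy; exists w; split.
  + by rewrite gt_eqF.
  + by rewrite !gtr0_norm; lra.
  + by rewrite E normrM.
- have [w /[!in_itv]/= /andP[yw wx] E] := mvt _ _ xy; exists w; split.
  + by rewrite lt_eqF.
  + by rewrite !ltr0_norm; lra.
  + by rewrite [LHS]distrC E normrM [`|y - x|]distrC.
Qed.

(* The neighbourhood is punctured so that no value at [x] has to be tracked
   when a factor vanishing at [x] is divided out. *)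
Definition vanishes f x m :=
  exists C, \forall y \near x^', `|f y| <= C * `|y - x| ^+ m.

Definition vanishes_along f s :=
  forall x, x \in s -> vanishes f x (count_mem x s).

Lemma eq_near_vanishes f g x m : (\forall y \near x^', f y = g y) ->
  vanishes f x m -> vanishes g x m.
Proof.
by move=> fg [C fC]; exists C; apply: filterS2 fg fC => y <-.
Qed.

Lemma continuous_vanishes f x : {for x, continuous f} -> vanishes f x 0.
Proof.
move=> cf; have fx : f y @[y --> x^'] --> f x by exact: cvg_within_filter.
exists (`|f x| + 1); have norm_lt : `|f x| < `|f x| + 1 by rewrite ltrDl.
near=> y; rewrite expr0 mulr1; near: y.
exact: (cvgr_norm_le (f x) fx _ norm_lt).
Unshelve. all: by end_near. Qed.

Lemma vanishesM f g x m n :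
  vanishes f x m -> vanishes g x n -> vanishes (f * g) x (m + n).
Proof.
move=> [C fC] [D gD]; exists (C * D); near=> y.
by rewrite normrM exprD mulrACA ler_pM//; near: y.
Unshelve. all: by end_near. Qed.

Lemma vanishes_eq0 f x m :
  {for x, continuous f} -> vanishes f x m.+1 -> f x = 0.
Proof.
move=> cf [C fC].
have fx : f y @[y --> x^'] --> f x by exact: cvg_within_filter.
have cvg_dist : `|y - x| @[y --> x^'] --> 0.
  rewrite -(_ : `|x - x| = 0); last by rewrite subrr normr0.
  apply: cvg_norm.
  by apply: cvgB; [exact: nbhs_dnbhs|exact: cvg_cst].
have cvg_bound : C * `|y - x| ^+ m.+1 @[y --> x^'] --> 0.
  rewrite -(_ : C * 0 ^+ m.+1 = 0); last by rewrite expr0n mulr0.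
  apply: cvgMl_tmp.
  apply: (cvg_comp (fun y => `|y - x|) (@GRing.exp R ^~ m.+1) cvg_dist).
  exact: exprn_continuous.
suff f0 : f y @[y --> x^'] --> 0 by exact: cvg_unique fx f0.
apply/norm_cvg0P; apply: squeeze_cvgr (cvg_cst 0) cvg_bound.
by near=> y; rewrite normr_ge0/=; near: y.
Unshelve. all: by end_near. Qed.

Lemma vanishes_comp f u x m : derivable u x 1 ->
  (\forall y \near x^', u y != u x) ->
  vanishes f (u x) m -> vanishes (f \o u) x m.
Proof.
move=> ux u_neq [C fC]; have [K uK] := derivable_lipschitz_at ux.
exists (`|C| * `|K| ^+ m).
have u_cvg : u y @[y --> x^'] --> u x.
  apply: cvg_within_filter; apply: differentiable_continuous.
  exact/derivable1_diffP.
have fuC : \forall y \near x^', u y != u x ->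
    `|f (u y)| <= C * `|u y - u x| ^+ m by exact: u_cvg fC.
apply: filterS3 u_neq uK fuC => y uyx uy /(_ uyx)/le_trans; apply=> /=.
apply: le_trans (ler_wpM2r _ (ler_norm C)) _; first exact: exprn_ge0.
rewrite -mulrA ler_wpM2l// -exprMn lerXn2r ?nnegrE ?mulr_ge0//.
by rewrite (le_trans uy)// ler_wpM2r// ler_norm.
Qed.

Lemma vanishes_divl f g x y m : (\forall z \near x^', f z = (z - y) * g z) ->
  vanishes f x ((y == x) + m) -> vanishes g x m.
Proof.
move=> fE [C fC]; have [yx|yx] := eqVneq y x.
  exists C; near=> z; have zx : 0 < `|z - x|.
    by rewrite normr_gt0 subr_eq0; near: z; exact: nbhs_dnbhs_neq.
  rewrite -(ler_pM2l zx) mulrCA -exprS -normrM -[in `|_ * _|]yx.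
  rewrite -(near fE z)//; near: z.
  by move: fC; rewrite yx eqxx.
have e0 : 0 < `|y - x| / 2 by rewrite divr_gt0 ?normr_gt0 ?subr_eq0.
exists (C / (`|y - x| / 2)); near=> z.
have fz : `|f z| <= C * `|z - x| ^+ m.
  by near: z; move: fC; rewrite (negPf yx).
have zx : `|z - x| < `|y - x| / 2.
  by near: z; apply/near_dnbhsP; exists (`|y - x| / 2).
have zy : `|y - x| / 2 <= `|z - y|.
  by have := ler_distD z y x; rewrite [`|y - z|]distrC; move: zx; lra.
rewrite mulrAC ler_pdivlMr// (le_trans _ fz)// (near fE z)// normrM mulrC.
by rewrite ler_wpM2r.
Unshelve. all: by end_near. Qed.

Lemma vanishes_primitive f x m : (forall y, derivable f y 1) -> f x = 0 ->
  vanishes (derive1 f) x m -> vanishes f x m.+1.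
Proof.
move=> df fx0 [C /near_dnbhsP[d d0 dfC]].
exists C; apply/near_dnbhsP; exists d => // y yx yd.
have [w [wx wy]] := mean_value_between df yx; rewrite fx0 subr0 => ->.
rewrite exprSr mulrA ler_wpM2r// (le_trans (dfC _ wx (le_lt_trans wy yd)))//.
have dist_gt0 z : z != x -> 0 < `|z - x| ^+ m.
  by move=> zx; rewrite exprn_gt0// normr_gt0 subr_eq0.
rewrite ler_wpM2l ?lerXn2r ?nnegrE// -(pmulr_lge0 _ (dist_gt0 _ wx)).
exact: le_trans (dfC _ wx (le_lt_trans wy yd)).
Qed.

Definition derivatives_vanish f x m :=
  forall j, (j < m)%N -> derive1n j f x = 0.

Definition derivatives_vanish_along f s :=
  forall x, x \in s -> derivatives_vanish f x (count_mem x s).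

Lemma smooth_vanishes f x m :
  smooth f -> derivatives_vanish f x m -> vanishes f x m.
Proof.
elim: m f => [|m IHm] f sf f0.
  by apply: continuous_vanishes; exact: smooth_continuous.
apply: vanishes_primitive; [move=> y; exact: smooth_derivable|exact: (f0 0%N)|].
apply: IHm => [|j jm]; first exact: smooth_derive1.
by have := f0 j.+1 jm; rewrite derive1Sn.
Qed.

End VanishingOrder.

Section DivideOutZeros.
Context {R : realType}.
Implicit Types (b h : int -> R) (s : seq R) (l r M w N : R).

Lemma laurent_divide_out b s : bientire b -> (forall l, l \in s -> 0 < l) ->
  vanishes_along (laurent b) s ->
  exists2 h,
    (forall r M, 0 < r -> r \notin s -> coef_bounded b r M ->
      coef_bounded h r (M / \prod_(l <- s) `|r - l|)) &
    (forall M, coef_bounded h 1 M ->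
      coef_bounded b 1 (\prod_(l <- s) (1 + l) * M)).
Proof.
elim: s b => [|l s IHs] b eb s_gt0 bs.
  by exists b => [r M _ _|M]; rewrite big_nil ?divr1 ?mul1r.
have [l_gt0 bl] : 0 < l /\ vanishes (laurent b) l (count_mem l s).+1.
  by split; [apply: s_gt0|have := bs l]; rewrite mem_head//= eqxx => /(_ isT).
have bl0 : laurent b l = 0.
  by apply: vanishes_eq0 bl; apply: continuous_laurent; rewrite ?gt_eqF.
have s_gt0' x : x \in s -> 0 < x by move=> xs; rewrite s_gt0// inE xs orbT.
have [x xs|h h_bounded h1] := IHs _ (bientire_laurent_quo l_gt0 eb bl0) s_gt0'.
  apply: (@vanishes_divl _ (laurent b) _ _ l).
    near=> z; apply: laurent_factor => //; near: z.
    apply/near_dnbhsP; exists x => [|z _]; first exact: s_gt0'.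
    by apply: contraTneq => ->; rewrite sub0r normrN gtr0_norm ?ltxx ?s_gt0'.
  by have := bs x; rewrite /= inE xs orbT => /(_ isT).
exists h => [r M r_gt0|M hM].
  rewrite inE negb_or => /andP[rl rs] bM.
  rewrite big_cons invfM mulrA; apply: h_bounded => //.
  exact: coef_bounded_laurent_quo.
by rewrite big_cons -mulrA; exact/coef_bounded1_laurent_quo/h1.
Unshelve. all: by end_near. Qed.

Lemma coef_bounded_ge0 b r M : coef_bounded b r M -> 0 <= M.
Proof. by move=> /(_ 0); rewrite mulr1; exact: le_trans. Qed.

Lemma coef_bounded1_geometric_mean b r M1 M2 : 0 < r ->
  coef_bounded b r M1 -> coef_bounded b r^-1 M2 ->
  coef_bounded b 1 (Num.sqrt (M1 * M2)).
Proof.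
move=> r_gt0 bM1 bM2 k; rewrite exp1rz mulr1 -[leLHS]ger0_norm// -sqrtr_sqr.
apply: ler_wsqrtr; have rk_gt0 := exprz_gt0 k r_gt0.
have := ler_pM _ _ (bM1 k) (bM2 k).
rewrite exprz_inv -invr_expz mulrACA divff ?gt_eqF// mulr1; apply.
  by rewrite mulr_ge0// ltW.
by rewrite divr_ge0// ltW.
Qed.

Lemma laurent_zeros_bound b s r M1 M2 k : bientire b ->
  (forall l, l \in s -> 0 < l) ->
  vanishes_along (laurent b) s ->
  0 < r -> r \notin s -> r^-1 \notin s ->
  coef_bounded b r M1 -> coef_bounded b r^-1 M2 ->
  `|b k| ^+ 2 * \prod_(l <- s) (`|r - l| * `|r^-1 - l|) <=
    M1 * M2 * \prod_(l <- s) (1 + l) ^+ 2.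
Proof.
move=> eb s_gt0 bs r_gt0 rs rVs bM1 bM2.
have [h h_bounded h1] := laurent_divide_out eb s_gt0 bs.
have dist_gt0 x : x \notin s -> 0 < \prod_(l <- s) `|x - l|.
  move=> xs; rewrite big_seq prodr_gt0// => l ls.
  by rewrite normr_gt0 subr_eq0; apply: contraNneq xs => ->.
have rV_gt0 : 0 < r^-1 by rewrite invr_gt0.
have hM1 := h_bounded _ _ r_gt0 rs bM1.
have hM2 := h_bounded _ _ rV_gt0 rVs bM2.
rewrite big_split prodrXl/=.
move: hM1 hM2 (dist_gt0 _ rs) (dist_gt0 _ rVs).
set D1 := \prod_(l <- s) `|r - l|; set D2 := \prod_(l <- s) `|_ - _|.
set P := \prod_(l <- s) _ in h1 * => hM1 hM2 D1_gt0 D2_gt0.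
have bk : `|b k| <= P * Num.sqrt (M1 / D1 * (M2 / D2)).
  have := h1 _ (coef_bounded1_geometric_mean r_gt0 hM1 hM2) k.
  by rewrite exp1rz mulr1.
rewrite -ler_pdivlMr ?mulr_gt0//.
have := bk; rewrite -ler_sqr ?nnegrE ?(le_trans _ bk)// => /le_trans; apply.
rewrite exprMn sqr_sqrtr; last first.
  exact: mulr_ge0 (coef_bounded_ge0 hM1) (coef_bounded_ge0 hM2).
rewrite [leLHS](_ : _ = M1 * M2 * P ^+ 2 / (D1 * D2))//.
by field; rewrite !gt_eqF.
Qed.

Lemma sqr1D_le_dist w l r :
  0 < l -> 1 <= w -> 6 * w * l <= r -> 6 * w <= r * l ->
  w * (1 + l) ^+ 2 <= `|r - l| * `|r^-1 - l|.
Proof.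
move=> l_gt0 w_ge1 wlr wrl; have r_gt0 : 0 < r by nra.
have r_far : r * (5 / 6) <= `|r - l| by rewrite ger0_norm; nra.
have rV_far : l * (5 / 6) <= `|r^-1 - l|.
  have : r^-1 <= l / 6 by rewrite -[r^-1]mul1r ler_pdivrMr//; nra.
  by rewrite distrC => ?; rewrite ger0_norm; lra.
apply: le_trans (ler_pM _ _ r_far rV_far); nra.
Qed.

(* The margin [5] is there for [6 <= expR 5]. *)
Lemma sqr1D_le_expR_dist l N : 0 < l -> `|ln l| <= N ->
  expR (N - `|ln l|) * (1 + l) ^+ 2 <=
    `|expR (N + 5) - l| * `|(expR (N + 5))^-1 - l|.
Proof.
move=> l_gt0 lN; have lE : expR (ln l) = l by rewrite lnK.
have /andP[lnN lnP] : - `|ln l| <= ln l <= `|ln l| by rewrite -ler_norml.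
have expR5 : 6 <= expR 5 :> R by have := expR_ge1Dx (5 : R); lra.
apply: sqr1D_le_dist => //.
- by rewrite -expR0 ler_expR subr_ge0.
- apply: (@le_trans _ _ (expR 5 * expR (N - `|ln l|) * l)).
    by rewrite !ler_wpM2r ?expR_ge0 ?(ltW l_gt0).
  by rewrite -{2}lE -!expRD ler_expR; lra.
- apply: (@le_trans _ _ (expR 5 * expR (N - `|ln l|))).
    by rewrite ler_wpM2r ?expR_ge0.
  by rewrite -[X in expR (N + 5) * X]lE -!expRD ler_expR; lra.
Qed.

Lemma laurent_jensen b s N M1 M2 k : bientire b ->
  (forall l, l \in s -> 0 < l /\ `|ln l| <= N) ->
  vanishes_along (laurent b) s ->
  coef_bounded b (expR (N + 5)) M1 -> coef_bounded b (expR (N + 5))^-1 M2 ->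
  `|b k| ^+ 2 * expR (\sum_(l <- s) (N - `|ln l|)) <= M1 * M2.
Proof.
move=> eb s_bd bs bM1 bM2; set r := expR (N + 5) in bM1 bM2.
have s_gt0 l : l \in s -> 0 < l by move=> /s_bd[].
have expR_notin x : N < `|x| -> expR x \notin s.
  by apply: contraTN => /s_bd[_]; rewrite expRK -leNgt.
have sqr1D_gt0 : 0 < \prod_(l <- s) (1 + l) ^+ 2.
  rewrite big_seq prodr_gt0// => l /s_gt0 l_gt0.
  by rewrite exprn_gt0// addr_gt0.
have N_lt : N < `|N + 5| by apply: lt_le_trans (ler_norm _); lra.
have rs : r \notin s by exact: expR_notin.
have rVs : r^-1 \notin s by rewrite -expRN expR_notin// normrN.
have dist_le := laurent_zeros_bound k eb s_gt0 bs (expR_gt0 _) rs rVs bM1 bM2.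
rewrite -(ler_pM2r sqr1D_gt0); apply: le_trans dist_le.
rewrite -mulrA ler_wpM2l ?exprn_ge0// expR_sum -big_split/=.
rewrite big_seq [leRHS]big_seq ler_prod// => l /s_bd[l_gt0 lN].
by rewrite mulr_ge0 ?expR_ge0 ?sqr_ge0//= sqr1D_le_expR_dist.
Qed.

End DivideOutZeros.

Definition jensen_bound (R : realType) (f : R -> R) (q K : R) :=
  forall (n : R) (s : seq R), (forall x, x \in s -> `|x| <= n) ->
  derivatives_vanish_along f s -> \sum_(x <- s) (n - `|x|) <= (n + q) ^+ 2 + K.

Section GaussianSeries.
Context {R : realType}.
Variables (a M : R) (d : int -> R).
Hypotheses (a_gt0 : 0 < a) (dM : forall k, `|d k| <= M).
Implicit Types (x r : R) (m : nat).

Definition gsum x : R := limn (gpsum a d x).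

Definition gpoint x := expR (2 * a * x).

Definition gcoef (k : int) : R := d k * gauss a k%:~R.

Lemma coef_bounded_gcoef r : 0 < r ->
  coef_bounded gcoef r (M * expR (ln r ^+ 2 / (4 * a))).
Proof.
move=> r_gt0 k; have g_gt0 : 0 < gauss a k%:~R by exact: expR_gt0.
have -> : r ^ k = expR (k%:~R * ln r).
  by rewrite -powR_intmul ?ltW// /powR gt_eqF.
rewrite /gcoef normrM (gtr0_norm g_gt0) -mulrA -expRD ler_pM//.
rewrite ler_expR -subr_ge0 (_ : _ - _ = a * (k%:~R - ln r / (2 * a)) ^+ 2).
  by rewrite mulr_ge0 ?sqr_ge0// ltW.
by field; rewrite gt_eqF.
Qed.

Lemma bientire_gcoef : bientire gcoef.
Proof. by move=> r r_gt0; eexists; exact: coef_bounded_gcoef. Qed.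

Lemma gauss_shiftE k x : d k * gauss a (x - k%:~R) =
  gauss a x * (gcoef k * gpoint x ^ k).
Proof.
rewrite /gpoint -powR_intmul ?expR_ge0// /powR gt_eqF ?expR_gt0// expRK.
transitivity (d k * (gauss a x * gauss a k%:~R * expR (k%:~R * (2 * a * x)))).
  by rewrite /gauss -!expRD; congr (_ * expR _); ring.
by rewrite /gcoef; ring.
Qed.

Lemma gpsumE x n : gpsum a d x n = gauss a x *
  (pseries (fun n => gcoef n%:Z) (gpoint x) n.+1 +
   (gpoint x)^-1 *
   pseries (fun n => gcoef (- 1 - n%:Z)) (gpoint x)^-1 n).
Proof.
rewrite /gpsum; under eq_bigr do rewrite gauss_shiftE.
rewrite -mulr_sumr; congr (_ * _).
rewrite (big_cat_nat (n := n))//=; last lia.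
rewrite addrC; congr (_ + _).
  rewrite -{1}[n]add0n big_addn (_ : (2 * n).+1 - n = n.+1)%N; last lia.
  by rewrite /pseries/series/=; apply: eq_bigr => i _; rewrite PoszD addrK.
rewrite big_nat_rev/= mulr_sumr /pseries/series/= !big_nat.
apply: eq_bigr => i /andP[_ ni].
have -> : (0 + n - i.+1)%N%:Z - n%:Z = - 1 - i%:Z by lia.
rewrite expfzDr ?gt_eqF ?expR_gt0// exprN1 -[_ ^ (- i%:Z)]exprnN exprVn.
by rewrite mulrCA.
Qed.

Lemma gsumE x : gsum x = gauss a x * laurent gcoef (gpoint x).
Proof.
apply/cvg_lim => //; have /funext-> := gpsumE x.
apply: cvgMl_tmp; apply: cvgD.
  rewrite (cvg_shiftS (pseries _ _)).
  exact/is_cvg_psum/bientire_entire_pos/bientire_gcoef.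
by apply: cvgMl_tmp; exact/is_cvg_psum/bientire_entire_neg/bientire_gcoef.
Qed.

Lemma gsum_neq0_coef x : gsum x <> 0 -> exists k, gcoef k != 0.
Proof.
move=> fx; apply: contra_notP fx => /forallNP gcoef0.
rewrite gsumE (_ : gcoef = fun=> 0) ?laurent0 ?mulr0//.
by apply/funext => k; apply/eqP/negPn/negP; exact: gcoef0.
Qed.

Lemma smooth_gsum : smooth gsum.
Proof.
have smooth_exp_scale k : smooth (expR \o (cst k * id)).
  exact/smooth_expR_comp/smooth_scale.
have -> : gsum = gauss a *
    (psum (fun n => gcoef n%:Z) \o (expR \o (cst (2 * a) * id)) +
     (expR \o (cst (- (2 * a)) * id)) *
     (psum (fun n => gcoef (- 1 - n%:Z)) \o (expR \o (cst (- (2 * a)) * id)))).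
  apply/funext => x; rewrite gsumE /laurent /gpoint !fctE/=.
  by rewrite !mulNr !expRN.
apply: smoothM; first exact: smooth_gauss.
apply: smoothD; last apply: smoothM => //; apply: smooth_comp => //.
- exact/smooth_psum/bientire_entire_pos/bientire_gcoef.
- exact/smooth_psum/bientire_entire_neg/bientire_gcoef.
Qed.

Lemma gsum_vanishes x m : derivatives_vanish gsum x m ->
  vanishes (laurent gcoef) (gpoint x) m.
Proof.
move=> gsum0; set l := gpoint x; have l_gt0 : 0 < l by exact: expR_gt0.
have a2 : 2 * a != 0 by rewrite mulf_neq0// gt_eqF.
pose u (z : R) := ln z / (2 * a).
have near_gt0 : \forall z \near l^', 0 < z.
  apply/near_dnbhsP; exists l => // z _; rewrite ltr_norml => /andP[]; lra.
have lxE : u l = x by rewrite /u expRK mulrAC divff// mul1r.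
have : vanishes ((gauss (- a) * gsum) \o u) l m.
  apply: vanishes_comp; rewrite ?lxE.
  - apply: derivableM => //; apply: ex_derive; exact: is_derive1_ln.
  - have z_neq_l : \forall z \near l^', z != l := nbhs_dnbhs_neq l.
    apply: filterS2 near_gt0 z_neq_l => z z_gt0; apply: contra_neq.
    by rewrite -lxE => /(divIf a2); apply: ln_inj; rewrite posrE.
  - rewrite -[m]add0n; apply: vanishesM.
      exact/continuous_vanishes/smooth_continuous/smooth_gauss.
    exact: smooth_vanishes smooth_gsum gsum0.
apply: eq_near_vanishes; apply: filterS near_gt0 => z z_gt0 /=.
rewrite !fctE gsumE /gauss mulrA -expRD mulNr opprK subrr expR0 mul1r.
by rewrite /gpoint /u mulrC divfK// lnK.
Qed.

Lemma gsum_zeros_bound (n : R) (s : seq R) k :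
  (forall x, x \in s -> `|x| <= n) ->
  derivatives_vanish_along gsum s ->
  `|gcoef k| ^+ 2 * expR (2 * a * \sum_(x <- s) (n - `|x|)) <=
    M ^+ 2 * expR ((2 * a * n + 5) ^+ 2 / (2 * a)).
Proof.
move=> sn s_zeros; have a2_gt0 : 0 < 2 * a by rewrite mulr_gt0.
pose N := 2 * a * n.
have gpoint_inj : injective gpoint.
  by move=> x y /expR_inj/mulfI->//; rewrite gt_eqF.
have ln_gpoint x : `|ln (gpoint x)| = 2 * a * `|x|.
  by rewrite expRK normrM gtr0_norm.
have zeros_bd l : l \in map gpoint s -> 0 < l /\ `|ln l| <= N.
  by move=> /mapP[x xs ->]; rewrite expR_gt0 ln_gpoint ler_pM2l// sn.
have zeros_vanish : vanishes_along (laurent gcoef) (map gpoint s).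
  move=> _ /mapP[x xs ->]; rewrite count_map (eq_count (a2 := pred1 x)).
    exact/gsum_vanishes/s_zeros.
  by move=> y /=; rewrite inj_eq.
have g_bd := coef_bounded_gcoef (expR_gt0 (N + 5)).
have gV_bd := coef_bounded_gcoef (expR_gt0 (- (N + 5))).
rewrite expRK in g_bd; rewrite expRK expRN sqrrN in gV_bd.
have := laurent_jensen k bientire_gcoef zeros_bd zeros_vanish g_bd gV_bd.
rewrite big_map mulr_sumr mulrACA -expr2 -expRD.
under eq_bigr do rewrite ln_gpoint -mulrBr.
rewrite (_ : _ / (4 * a) + _ = (N + 5) ^+ 2 / (2 * a))//.
by field; rewrite gt_eqF.
Qed.

Lemma gsum_jensen x0 :
  gsum x0 <> 0 -> exists K, jensen_bound gsum (5 / (2 * a)) K.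
Proof.
move=> /gsum_neq0_coef[k bk]; have a2_gt0 : 0 < 2 * a by rewrite mulr_gt0.
have bk_gt0 : 0 < `|gcoef k| ^+ 2 by rewrite exprn_gt0// normr_gt0.
exists (ln (M ^+ 2 / `|gcoef k| ^+ 2) / (2 * a)) => n s sn s_zeros.
have := gsum_zeros_bound k sn s_zeros.
rewrite mulrC -ler_pdivlMr// [leRHS]mulrAC.
set ratio := M ^+ 2 / _; set S := \sum_(x <- s) _ => bound.
have ratio_gt0 : 0 < ratio.
  rewrite -(pmulr_lgt0 _ (expR_gt0 ((2 * a * n + 5) ^+ 2 / (2 * a)))).
  exact: lt_le_trans (expR_gt0 _) bound.
have {bound} : 2 * a * S <= ln ratio + (2 * a * n + 5) ^+ 2 / (2 * a).
  rewrite -ler_expR (le_trans bound)// expRD lnK//.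
have -> : (n + 5 / (2 * a)) ^+ 2 = (2 * a * n + 5) ^+ 2 / (2 * a) / (2 * a).
  by field; rewrite gt_eqF.
by rewrite -mulrDl ler_pdivlMr// mulrC addrC.
Qed.

End GaussianSeries.

Section LowerDensity.
Context {R : realType}.
Implicit Types (N : set R) (m : R -> \bar R) (r x y D q K : R).

Lemma le_esum_subset (T : choiceType) (I J : set T) (u v : T -> \bar R) :
  I `<=` J -> (forall i, I i -> (u i <= v i)%E) ->
  (forall j, J j -> (0 <= v j)%E) ->
  (\esum_(i in I) u i <= \esum_(j in J) v j)%E.
Proof.
move=> IJ uv v0; rewrite esum_mkcond [leRHS]esum_mkcond; apply: le_esum => i _.
case: ifPn => [/set_mem Ii|_]; first by rewrite mem_set ?uv//; exact: IJ.
by case: ifPn => // /set_mem; exact: v0.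
Qed.

Lemma le_lower_density N N' m m' : N `<=` N' ->
  (forall x, N x -> (m x <= m' x)%E) -> (forall x, (0 <= m' x)%E) ->
  (lower_density N m <= lower_density N' m')%E.
Proof.
move=> NN' mm' m'0; apply: ge_ereal_sup => _ [r0 _ <-].
apply: le_trans (ereal_sup_ubound _); last by exists r0.
apply: le_ereal_inf_tmp => _ [r r0r <-].
apply: le_trans (ereal_inf_lbound _) _; first by exists r.
apply: le_ereal_inf_tmp => _ [x _ <-].
apply: le_trans (ereal_inf_lbound _) _; first by exists x.
have [r_ge0|r_lt0] := leP 0 r; last first.
  have window0 (S : set R) : S `&` [set l | x - r <= l <= x + r] = set0.
    by apply/seteqP; split=> // l [_ /andP[]]; lra.
  by rewrite !window0 !esum_set0.
rewrite lee_wpmul2l// ?lee_fin ?invr_ge0 ?mulr_ge0//.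
by apply: le_esum_subset => // [l [/NN']|l [/mm']].
Qed.

Lemma lt_lower_density N m D : (D%:E < lower_density N m)%E ->
  exists r0, forall r x, r0 <= r -> (D%:E <= ((2 * r)^-1)%:E *
    \esum_(l in N `&` [set l : R | (x - r <= l <= x + r)%R]) m l)%E.
Proof.
move=> /ereal_sup_gt[_ [r0 _ <-] DN]; exists r0 => r x r0r.
apply: le_trans (ltW DN) (le_trans (ereal_inf_lbound _) _); first by exists r.
by apply: ereal_inf_lbound; exists x.
Qed.

Lemma sum_indic_le_sub (n : nat) y : 0 <= y <= n%:R ->
  \sum_(0 <= j < n) (y <= j%:R)%R%:R <= n%:R - y.
Proof.
elim: n => [|n IHn] /andP[y0 yn]; first by rewrite big_geq//; lra.
rewrite big_nat_recr//= -natr1; have [ynn|ny] := leP y n%:R.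
  by have := IHn; rewrite y0 ynn /= => /(_ isT); lra.
rewrite addr0 big_nat big1; first by rewrite natr1; lra.
by move=> i /andP[_ ni]; rewrite leNgt (lt_trans _ ny)// ltr_nat.
Qed.

Definition window N r : set R := N `&` [set l | `|l| <= r].

(* A discrete form of [\int_0^n #{|l| <= r} dr = \sum_l (n - |l|)]. *)
Lemma sum_esum_window_le N m (n : nat) : (forall x, (0 <= m x)%E) ->
  (\sum_(0 <= j < n) \esum_(l in window N j%:R) m l <=
   \esum_(l in window N n%:R) m l * (n%:R - `|l|)%:E)%E.
Proof.
move=> m0; have windowE j : (j < n)%N ->
    \esum_(l in window N j%:R) m l =
    (\esum_(l in window N n%:R) m l * ((`|l| <= j%:R)%R%:R)%:E)%E.
  move=> jn; have -> : window N j%:R = window N n%:R `&` [set l | `|l| <= j%:R].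
    rewrite /window -setIA; congr setI.
    apply/seteqP; split=> l /=; last by case.
    by move=> lj; split=> //; rewrite (le_trans lj)// ler_nat ltnW.
  rewrite esum_mkcondr; apply: eq_esum => l _; case: ifPn => [/set_mem/= ->|].
    by rewrite mule1.
  by move=> /asboolPn/= /negP/negPf->; rewrite mule0.
rewrite big_nat (eq_bigr (fun j : nat => \esum_(l in window N n%:R)
    (m l * ((`|l| <= j%:R)%R%:R)%:E)%E)) => [|j /andP[_ /windowE]//].
rewrite -big_nat -esum_sum => [|l j _ _]; last by rewrite mule_ge0 ?lee_fin.
apply: le_esum => l [_ /= ln].
rewrite -ge0_sume_distrr => [|j _]; last by rewrite lee_fin.
by rewrite lee_wpmul2l// sumEFin lee_fin sum_indic_le_sub// normr_ge0.
Qed.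

Lemma sum_double_sub (n : nat) y :
  \sum_(0 <= j < n) 2 * (j%:R - y) = n%:R * (n%:R - 1 - 2 * y).
Proof.
elim: n => [|n IHn]; first by rewrite big_geq// mul0r.
by rewrite big_nat_recr//= IHn -natr1; ring.
Qed.

Lemma quadratic_unbounded (e A B : R) : 0 < e ->
  ~ forall n : nat, e * n%:R ^+ 2 <= A * n%:R + B.
Proof.
move=> e0 bounded; pose n := (Num.bound ((`|A| + `|B|) / e)).+1.
have n_ge1 : 1 <= n%:R :> R by rewrite ler1n.
have n_gt : `|A| + `|B| < n%:R * e.
  rewrite -ltr_pdivrMr//; apply: lt_le_trans (archi_boundP _) _.
    by rewrite divr_ge0 ?addr_ge0 ?(ltW e0).
  by rewrite ler_nat.
have An : A * n%:R <= `|A| * n%:R by rewrite ler_wpM2r ?ler_norm.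
have Bn : B <= `|B| * n%:R by rewrite (le_trans (ler_norm _))// ler_peMr.
have := bounded n; nra.
Qed.

Lemma lower_density_le1 N m q K : (forall x, (0 <= m x)%E) ->
  (forall n : nat, (\esum_(l in window N n%:R)
    m l * (n%:R - `|l|)%:E <= ((n%:R + q) ^+ 2 + K)%:E)%E) ->
  (lower_density N m <= 1)%E.
Proof.
move=> m0 bound; apply/lee_addgt0Pr => e e0; rewrite leNgt -EFinD; apply/negP.
move=> /lt_lower_density[r0 dense]; set D := 1 + e in dense.
have D_gt0 : 0 < D by rewrite addr_gt0.
have window_ge (j : nat) :
    ((D * (2 * (j%:R - `|r0|)))%:E <= \esum_(l in window N j%:R) m l)%E.
  have [jr0|r0j] := leP j%:R `|r0|.
    apply: (@le_trans _ _ 0%E); last exact: esum_ge0.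
    by rewrite lee_fin !pmulr_rle0// subr_le0.
  have j_gt0 : 0 < j%:R :> R := le_lt_trans (normr_ge0 _) r0j.
  have := dense j%:R 0 (le_trans (ler_norm _) (ltW r0j)).
  rewrite lee_pdivlMl ?mulr_gt0// -EFinM (_ : N `&` _ = window N j%:R).
    by apply: le_trans; rewrite lee_fin mulrC !ler_pM2r ?ler_pM2l// gerBl.
  by congr setI; apply/seteqP; split=> l /=; rewrite sub0r add0r ler_norml.
pose A := D + 2 * D * `|r0| + 2 * q.
apply: (@quadratic_unbounded e A (q ^+ 2 + K)) => // n.
have sum_ge : ((D * (n%:R * (n%:R - 1 - 2 * `|r0|)))%:E <=
    \sum_(0 <= j < n) \esum_(l in window N j%:R) m l)%E.
  rewrite -sum_double_sub mulr_sumr -sumEFin.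
  by apply: lee_sum => j _; exact: window_ge.
have := le_trans sum_ge (le_trans (sum_esum_window_le N n m0) (bound n)).
by rewrite lee_fin /A /D; lra.
Qed.

End LowerDensity.

Section SeqOfMultiplicity.
Variables (T : eqType) (mu : T -> nat).
Implicit Types (Z : seq T) (x : T).

Definition seq_of_mult Z := flatten [seq nseq (mu x) x | x <- Z].

Lemma mem_seq_of_mult Z x : x \in seq_of_mult Z -> x \in Z.
Proof.
by move=> /flattenP[_ /mapP[y yZ ->]]; rewrite mem_nseq => /andP[_ /eqP->].
Qed.

Lemma count_seq_of_mult Z x : uniq Z -> x \in Z ->
  count_mem x (seq_of_mult Z) = mu x.
Proof.
move=> Z_uniq xZ; rewrite /seq_of_mult count_flatten -map_comp sumnE big_map.
rewrite (bigD1_seq x)//= count_nseq /= eqxx mul1n big1 ?addn0// => y /negPf yx.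
by rewrite count_nseq /= yx.
Qed.

Lemma sum_seq_of_mult (V : nmodType) (F : T -> V) Z :
  \sum_(x <- seq_of_mult Z) F x = \sum_(x <- Z) F x *+ mu x.
Proof.
rewrite /seq_of_mult big_flatten big_map; apply: eq_bigr => x _.
by rewrite big_nseq -Monoid.iteropE.
Qed.

End SeqOfMultiplicity.

Section ZeroDensity.
Context {R : realType}.
Implicit Types (f : R -> R) (x n q K : R) (S : set nat).

Definition zero_order f x : \bar R :=
  ereal_sup [set (m%:R)%:E | m in [set m | derivatives_vanish f x m]].

Lemma zero_order_ge0 f x : (0 <= zero_order f x)%E.
Proof. by apply: ereal_sup_ubound; exists 0%N. Qed.

Lemma ereal_sup_nat_attained S (k : nat) (B : R) : S k ->
  (forall m, S m -> m%:R <= B) ->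
  exists2 m, S m & ereal_sup [set (m%:R)%:E | m in S] = (m%:R)%:E :> \bar R.
Proof.
move=> Sk SB; have exS : exists m, `[< S m >] by exists k; exact/asboolP.
have S_le m : `[< S m >] -> (m <= Num.bound `|B|)%N.
  move=> /asboolP/SB mB; rewrite -(ler_nat R) (le_trans mB)//.
  by rewrite (le_trans (ler_norm _))// ltW// archi_boundP.
have [m /asboolP Sm m_max] := ex_maxnP exS S_le; exists m => //.
apply/eqP; rewrite eq_le ereal_sup_ubound ?andbT; last by exists m.
apply: ge_ereal_sup => _ [i Si <-]; rewrite lee_fin ler_nat.
exact/m_max/asboolP.
Qed.

Section JensenBound.
Variables (f : R -> R) (q K : R).
Hypothesis jensen : jensen_bound f q K.

Lemma zero_order_attained x :
  exists2 m, derivatives_vanish f x m & zero_order f x = (m%:R)%:E.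
Proof.
apply: (@ereal_sup_nat_attained _ 0 ((`|x| + 1 + q) ^+ 2 + K)) => // m xm.
have <- : \sum_(y <- nseq m x) (`|x| + 1 - `|y|) = m%:R.
  by rewrite big_nseq -Monoid.iteropE /= addrC addKr.
apply: jensen => y.
  by rewrite mem_nseq => /andP[_ /eqP->]; rewrite lerDl.
by rewrite mem_nseq => /andP[_ /eqP->]; rewrite count_nseq /= eqxx mul1n.
Qed.

Lemma esum_zero_order_le n :
  (\esum_(x in window setT n) zero_order f x * (n - `|x|)%:E <=
    ((n + q) ^+ 2 + K)%:E)%E.
Proof.
have /choice[mu mu_order] x :
    exists m, derivatives_vanish f x m /\ zero_order f x = (m%:R)%:E.
  by have [m] := zero_order_attained x; exists m.
apply: ge_ereal_sup => _ [F [finF Fn] <-].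
rewrite fsbig_finite//=; set Z := finmap.enum_fset _.
under eq_bigr do rewrite (mu_order _).2 -EFinM.
rewrite sumEFin lee_fin; under eq_bigr do rewrite mulr_natl.
rewrite -sum_seq_of_mult.
have Zn x : x \in Z -> `|x| <= n.
  by rewrite in_fset_set// => /set_mem/Fn[].
apply: jensen => x => [/mem_seq_of_mult/Zn//|xs].
rewrite count_seq_of_mult ?finmap.fset_uniq ?(mem_seq_of_mult xs)//.
by case: (mu_order x).
Qed.

Lemma lower_density_zero_order_le1 : (lower_density setT (zero_order f) <= 1)%E.
Proof.
apply: lower_density_le1 => [x|n]; first exact: zero_order_ge0.
exact: esum_zero_order_le.
Qed.

End JensenBound.

End ZeroDensity.

Lemma lower_density_gsum_zeros_le1 (R : realType) (a M : R) (d : int -> R)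
    (x0 : R) : 0 < a -> (forall k, `|d k| <= M) -> gsum a d x0 <> 0 ->
  (lower_density setT (zero_order (gsum a d)) <= 1)%E.
Proof.
move=> a_gt0 dM d_neq0; have [K jensen] := gsum_jensen a_gt0 dM d_neq0.
exact: lower_density_zero_order_le1 jensen.
Qed.

Theorem theorem4p3 (R : realType) (a : R) (c : int -> R[i]) :
  0 < a ->
  (exists M : R, forall k : int, `|c k| <= (M%:C)%C) ->
  (exists x : R, fRe a c x <> 0 \/ fIm a c x <> 0) ->
  (lower_density (zeroset a c) (mult a c) <= 1)%E.
Proof.
move=> a_gt0 [M cM] [x0 f_neq0].
have le1_of_part d x1 : (forall k, `|d k| <= M) -> gsum a d x1 <> 0 ->
    (forall x, mult a c x <= zero_order (gsum a d) x)%E ->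
    (lower_density (zeroset a c) (mult a c) <= 1)%E.
  move=> dM d_neq0 mult_le.
  apply: le_trans (lower_density_gsum_zeros_le1 a_gt0 dM d_neq0).
  by apply: le_lower_density => // x; exact: zero_order_ge0.
case: f_neq0 => [re_neq0|im_neq0].
- apply: le1_of_part re_neq0 _ => [k|x].
    by rewrite -lecR (le_trans (normc_ge_Re _)).
  by apply: le_ereal_sup => _ [m xm <-]; exists m => // j /xm[].
- apply: le1_of_part im_neq0 _ => [k|x].
    have := cM k; rewrite normc_def lecR; apply: le_trans.
    by rewrite -sqrtr_sqr ler_wsqrtr// lerDr sqr_ge0.
  by apply: le_ereal_sup => _ [m xm <-]; exists m => // j /xm[].
Qed.
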